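(* For $b\in\mathbb{R}$, $n\in\mathbb{N}$ and $k\in\mathbb{Z}\setminus\{b\}$, let $$\psi_{n,k}^b(x,\theta)=e^{ik\theta}\,\frac1x\,W_{n,\frac12}(|k-b|x^2),\qquad (x,\theta)\in M_+=(0,\infty)\times\mathbb{S}^1.$$ Fix $k\in\mathbb{Z}$. Then for any $\lambda\in\mathbb{Q}$, $\lambda>0$, there exists a sequence of pairs $(b_j,n_j)\in\left(k-\frac12,k+\frac12\right)\times\mathbb{N}$, with $b_j\to k$ and $n_j\to\infty$, such that $$\psi_{n_j,k}^{b_j}(x,\theta)\to e^{ik\theta}\,\frac{\sqrt\lambda}2\,J_1(\sqrt\lambda\,x)$$ uniformly on compact sets, where $J_\nu$ is the Bessel function of the first kind of order $\nu$. The limit function on the right-hand side is the generalised eigenfunction of $\Delta^b$ at $b=k$ with generalised eigenvalue $\lambda$.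
   Context: $\mathbb{N}=\{1,2,3,\dots\}$; $b_j\neq k$ so that $\psi^{b_j}_{n_j,k}$ is defined. $\Delta^b=\partial_x^2-\frac1x\partial_x+|x|^2(\partial_\theta^2-2ib\,\partial_\theta-b^2)$ is the Aharonov-Bohm magnetic Laplace-Beltrami operator on $L^2(M_+,\frac1x\,dx\,d\theta)$, and the $\psi_{n,k}^b$ are the (non-normalized) functions the paper associates with the eigenvalues $\lambda_{n,k}^b=4n|k-b|$ of $-\Delta^b$. The function $W_{n,\frac12}$, $n\in\mathbb{N}$, is the Whittaker $W$-function with the normalization $$W_{n,\frac12}(z)=(-1)^{n-1}z\,e^{-z/2}L^1_{n-1}(z),$$ where $L_m^\alpha$ is the generalised Laguerre polynomial of degree $m$ with parameter $\alpha$. Generalised eigenfunctions: with the paper's map $Uv(x)=\sqrt x\,v(x)$, the $k$-th Fourier component of $\Delta^b$ at $b=k$ is represented by $L_0=\partial_x^2-\frac34\frac1{x^2}$ on $(0,\infty)$; for $\lambda>0$ the generalised eigenfunctions are the functions $e^{ik\theta}\,U^{-1}u(x)=e^{ik\theta}x^{-1/2}u(x)$ with $u$ a solution of $-L_0u=\lambda u$, i.e. $u(x)=c_1\sqrt x\,J_1(\sqrt\lambda x)+c_2\sqrt x\,Y_1(\sqrt\lambda x)$. *)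

(* Defs.v *)
From HB Require Import structures.
From mathcomp Require Import all_boot all_order all_algebra.
From mathcomp Require Import complex.
From mathcomp Require Import all_classical all_reals all_analysis.

Set Implicit Arguments.
Unset Strict Implicit.
Unset Printing Implicit Defensive.

Import Order.TTheory GRing.Theory Num.Theory.
Import numFieldNormedType.Exports.

Local Open Scope classical_set_scope.
Local Open Scope ring_scope.
Local Open Scope complex_scope.

Section Defs.
Variable R : realType.
Implicit Types (x t z b lam : R) (n m a nu : nat) (k : int).

(* The generalised Laguerre polynomial of degree m with parameter a, for a
   natural number a (only a = 1 is needed). *)
Definition laguerre a m : {poly R} :=
  \poly_(i < m.+1) ((-1) ^+ i * 'C(m + a, m - i)%:R / i`!%:R).

(* W_{n,1/2} for n >= 1, with the normalization
   (-1)^(n-1) z e^(-z/2) L^1_(n-1)(z) (there is no factor (n-1)!). *)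
Definition whittakerW n z : R :=
  (-1) ^+ n.-1 * z * expR (- z / 2) * (laguerre 1 n.-1).[z].

(* J_nu for a natural order nu, so that Gamma(m + nu + 1) = (m + nu)!. *)
Definition besselJ nu x : R :=
  limn (series (fun m =>
    (-1) ^+ m / (m`!%:R * (m + nu)`!%:R) * (x / 2) ^+ (2 * m + nu))).

Definition expi t : R[i] := cos t +i* sin t.

(* M_+ = (0, oo) x S^1, with S^1 realised as the unit circle of R[i]. The copy
   R[i]^o of R[i] is the one that carries the usual topology. *)
Definition Mplus : set (R * R[i]^o) := [set p | 0 < p.1 /\ `|p.2| = 1].

(* Functions on M_+ are written in the coordinates (x, t), t being an angle
   modulo 2 pi; this is the point of M_+ with coordinates (x, t). *)
Definition chart (p : R * R) : R * R[i]^o := (p.1, expi p.2).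

Definition cvg_uniformly_on_compacts
    (f : nat -> R * R -> R[i]^o) (g : R * R -> R[i]^o) : Prop :=
  forall K : set (R * R[i]^o), compact K -> K `<=` Mplus ->
    {uniform chart @^-1` K, f @ \oo --> g}.

Definition psi b n k (p : R * R) : R[i]^o :=
  expi (k%:~R * p.2) * (p.1^-1 * whittakerW n (`|k%:~R - b| * p.1 ^+ 2))%:C.

Definition L0 (u : R -> R) x : R := (u^`(2))%classic x - 3 / 4 / x ^+ 2 * u x.

Definition solves_L0 lam (u : R -> R) : Prop :=
  forall x, 0 < x ->
    [/\ derivable u x 1, derivable (u^`())%classic x 1 & - L0 u x = lam * u x].

(* The inverse of (U v)(x) = sqrt x * v x. *)
Definition Uinv (u : R -> R[i]) x : R[i] := (Num.sqrt x)^-1%:C * u x.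

(* Generalised eigenfunctions, with generalised eigenvalue lam, of the magnetic
   Laplacian with b = k, in its k-th Fourier component: the latter is
   represented by L0 through U. The coefficients of L0 are real, so that a
   complex-valued u solves the equation iff its real and imaginary parts do. *)
Definition generalised_eigenfunction k lam (f : R * R -> R[i]) : Prop :=
  exists u : R -> R[i],
    [/\ solves_L0 lam (fun x => complex.Re (u x)),
        solves_L0 lam (fun x => complex.Im (u x)),
        exists2 x, 0 < x & u x != 0
      & forall x t, 0 < x -> f (x, t) = expi (k%:~R * t) * Uinv u x].

Definition limit_fun k lam (p : R * R) : R[i]^o :=
  expi (k%:~R * p.2) *
    (Num.sqrt lam / 2 * besselJ 1 (Num.sqrt lam * p.1))%:C.

End Defs.

(* Main.v *)
(* Write [L^1_(n-1)(z) = n * sum_i r_(n,i+1) (-1)^i (n z)^i / (i! (i+1)!)] with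
   [r_(n,i) = n (n-1) ... (n-i+1) / n^i]. When [n * beta = lam / 4], the value
   [n z] at [z = beta x^2] is [y = lam x^2 / 4], independent of [n], and as
   [1 - r_(n,i) <= i (i-1) / (2 n)], the sum is within [exp(y) / n] of its limit
   [F y = sum_i (-1)^i y^i / (i! (i+1)!)], which is a Bessel function since
   [J_1 x = (x / 2) F (x^2 / 4)]. The exponential factor [exp (- beta x^2 / 2)]
   is [1 - O(1/n)] for bounded [x]. So [b_j = k + lam / (4 n_j)] works for any
   sequence of odd [n_j] tending to infinity, odd because of the sign
   [(-1)^(n-1)]. The equation satisfied by [J_1] amounts to
   [y F'' + 2 F' + F = 0], which says
   [i (i+1) a_(i+1) + 2 (i+1) a_(i+1) + a_i = 0] for the coefficients [a_i] of [F]. *)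

Require Import Defs.
From HB Require Import structures.
From mathcomp Require Import all_boot all_order all_algebra.
From mathcomp Require Import complex ring lra zify.
From mathcomp Require Import all_classical all_reals all_analysis.

Set Implicit Arguments.
Unset Strict Implicit.
Unset Printing Implicit Defensive.

Import Order.TTheory GRing.Theory Num.Theory.
Import numFieldNormedType.Exports.

Local Open Scope classical_set_scope.
Local Open Scope ring_scope.

(** * Power series dominated by the exponential series *)

Lemma norm_pseries_term_le (R : realType) (c : nat -> R) (M x : R) :
  (forall i, `|c i| <= M / i`!%:R) ->
  forall i, `|c i * x ^+ i| <= M * exp_coeff `|x| i.
Proof.
by move=> cM i; rewrite normrM normrX /exp_coeff /= mulrA mulrAC ler_wpM2r ?exprn_ge0.
Qed.

Lemma is_cvg_normed_pseries (R : realType) (c : nat -> R) (M x : R) :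
  (forall i, `|c i| <= M / i`!%:R) ->
  cvgn [normed series (fun i => c i * x ^+ i)].
Proof.
move=> cM; have M0 : 0 <= M.
  by have := le_trans (normr_ge0 _) (cM 0); rewrite fact0 divr1.
apply: (@series_le_cvg _ _ (fun i => M * exp_coeff `|x| i)) => [i|i|i|] /=.
- exact: normr_ge0.
- by rewrite mulr_ge0// exp_coeff_ge0.
- exact: norm_pseries_term_le.
- exact: is_cvg_seriesZ (is_cvg_series_exp_coeff _).
Qed.

Lemma is_cvg_pseries_fact (R : realType) (c : nat -> R) (M x : R) :
  (forall i, `|c i| <= M / i`!%:R) -> cvgn (pseries c x).
Proof. by move=> cM; apply: normed_cvg; exact: is_cvg_normed_pseries cM. Qed.

(** Used with [M = 1] to bound [besselF], and with [M = 1 / n] to bound the distance from the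
    Laguerre series to it. *)
Lemma norm_lim_pseries_le (R : realType) (c : nat -> R) (M x : R) :
  (forall i, `|c i| <= M / i`!%:R) ->
  `|limn (pseries c x)| <= M * expR `|x|.
Proof.
move=> cM; apply: le_trans (lim_series_norm _) _; first exact: is_cvg_normed_pseries cM.
have cE := is_cvg_series_exp_coeff `|x|.
rewrite /expR -[M * _](lim_seriesZ M cE).
apply: lim_series_le; [exact: is_cvg_normed_pseries cM|exact: is_cvg_seriesZ|].
by move=> i; exact: norm_pseries_term_le.
Qed.

(** Since [(i+1) / (i+1)! = 1 / i!], the domination survives termwise differentiation with the same
    [M], and so can be iterated. *)
Lemma pseries_diffs_fact (R : realType) (c : nat -> R) (M : R) :
  (forall i, `|c i| <= M / i`!%:R) ->
  forall i, `|pseries_diffs c i| <= M / i`!%:R.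
Proof.
move=> cM i; rewrite /pseries_diffs normrM ger0_norm//.
apply: le_trans (ler_wpM2l _ (cM _)) _ => //.
by rewrite factS natrM invfM mulrCA mulVKf// pnatr_eq0.
Qed.

Lemma is_derive_pseries_fact (R : realType) (c : nat -> R) (M x : R) :
  (forall i, `|c i| <= M / i`!%:R) ->
  is_derive x 1 (fun y => limn (pseries c y)) (limn (pseries (pseries_diffs c) x)).
Proof.
move=> cM; have dM := pseries_diffs_fact cM; have ddM := pseries_diffs_fact dM.
(* Termwise differentiation at [x] asks for convergence at a point of larger modulus; [|x| + 1] is
   one. *)
apply: (@pseries_snd_diffs _ _ (`|x| + 1)).
- exact: is_cvg_pseries_fact cM.
- exact: is_cvg_pseries_fact dM.
- exact: is_cvg_pseries_fact ddM.
- by rewrite [ltRHS]ger0_norm ?addr_ge0// ltrDl.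
Qed.

(** * The series [F] behind [J_1] and its differential equation *)

Definition besselF_coef (R : realType) (i : nat) : R :=
  (-1) ^+ i / (i`!%:R * i.+1`!%:R).

Definition besselF (R : realType) (y : R) : R :=
  limn (pseries (besselF_coef R) y).

Lemma besselF_coef_fact (R : realType) i :
  `|besselF_coef R i| <= 1 / i`!%:R.
Proof.
rewrite /besselF_coef normrM normrX normrN1 expr1n mul1r normfV normrM !ger0_norm//.
rewrite invfM mul1r ler_piMr ?invr_ge0// invf_le1 ?ltr0n ?fact_gt0//.
by rewrite ler1n fact_gt0.
Qed.

Lemma besselJ1E (R : realType) (x : R) :
  besselJ 1 x = x / 2 * besselF ((x / 2) ^+ 2).
Proof.
rewrite /besselJ /besselF.
rewrite -[RHS](lim_seriesZ (x / 2)); last exact: is_cvg_pseries_fact (besselF_coef_fact R).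
congr (limn (series _)); apply/funext => i.
by rewrite /besselF_coef /= !addn1 exprS exprM mulrCA.
Qed.

Lemma besselF_ode (R : realType) (y : R) :
  let c := besselF_coef R in
  y * limn (pseries (pseries_diffs (pseries_diffs c)) y)
    + 2 * limn (pseries (pseries_diffs c) y) + besselF y = 0.
Proof.
move=> c; have cM := besselF_coef_fact R; rewrite -/c in cM.
have dM := pseries_diffs_fact cM; have ddM := pseries_diffs_fact dM.
have cc := @is_cvg_pseries_fact _ _ _ y cM.
have cd := @is_cvg_pseries_fact _ _ _ y dM; have cdd := @is_cvg_pseries_fact _ _ _ y ddM.
(* In the form [i c'_i y^(i-1)], the second derivative times [y] has [y^i] in its term of index [i],
   like the other two series, so the partial sums vanish term by term. *)
have h1 := pseries_diffs_equiv cdd.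
have h : (fun n => y * series (fun i => i%:R * pseries_diffs c i * y ^+ i.-1) n
   + 2 * pseries (pseries_diffs c) y n + pseries c y n) @ \oo -->
   y * limn (pseries (pseries_diffs (pseries_diffs c)) y)
    + 2 * limn (pseries (pseries_diffs c) y) + besselF y.
  apply: cvgD => //; apply: cvgD; apply: cvgM; [exact: cvg_cst|exact: h1
    |exact: cvg_cst|exact: cd].
rewrite -(cvg_lim _ h)//; apply: lim_near_cst => //.
apply: nearW => n; rewrite /pseries !seriesEnat /= !mulr_sumr -!big_split /=.
apply: big1 => -[|i] _ /=; rewrite /pseries_diffs /c /besselF_coef.
  by rewrite !factS !fact0 /=; field.
have ne j : (j`!%:R : R) != 0 by rewrite pnatr_eq0 -lt0n fact_gt0.
have i0 : (i%:R : R) >= 0 by [].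
rewrite !factS !natrM !exprS -!natr1; field.
by rewrite ne /=; apply/and3P; split; lra.
Qed.

(** * Laguerre polynomials as perturbations of [F] *)

Definition ffact_ratio (R : realType) (n i : nat) : R := (n ^_ i)%:R / n%:R ^+ i.

Lemma ffact_ratio_le1 (R : realType) (n i : nat) : (0 < n)%N ->
  ffact_ratio R n i <= 1.
Proof.
move=> n0; rewrite ler_pdivrMr ?exprn_gt0 ?ltr0n// mul1r -natrX ler_nat.
elim: i => [|i IH]; first by rewrite ffactn0.
by rewrite ffactnSr expnSr leq_mul// leq_subr.
Qed.

(** The ratio is the product of the [1 - j / n] for [j < i]. As it is at most 1, a new factor
    [1 - i / n] lowers it by at most [i / n], and these losses add up to ['C(i, 2) / n]. *)
Lemma ffact_ratio_ge (R : realType) (n i : nat) : (0 < n)%N ->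
  1 - 'C(i, 2)%:R / n%:R <= ffact_ratio R n i.
Proof.
move=> n0; have n0R : (0 : R) < n%:R by rewrite ltr0n.
elim: i => [|i IH]; first by rewrite /ffact_ratio ffactn0 bin0n mul0r subr0 divr1.
have q0 : 0 <= ffact_ratio R n i by rewrite divr_ge0.
have q1 := ffact_ratio_le1 R i n0.
(* The inequality absorbs the truncation of [n - i] at 0 when [i > n]. *)
have h : ffact_ratio R n i * (1 - i%:R / n%:R) <= ffact_ratio R n i.+1.
  rewrite /ffact_ratio ffactnSr natrM exprSr invfM mulrACA ler_wpM2l//.
  rewrite ler_pdivlMr// mulrBl divfK ?gt_eqF// mul1r lerBlDr -natrD ler_nat.
  by rewrite addnC -leq_subLR.
apply: le_trans h.
rewrite binS bin1 natrD mulrDl opprD addrA.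
rewrite mulrBr mulr1 lerB//.
by rewrite ler_piMl// divr_ge0.
Qed.

(** It vanishes for [i >= n], as the falling factorial does, so its power series is a polynomial. *)
Definition laguerre_coef (R : realType) (n i : nat) : R :=
  ffact_ratio R n i.+1 * besselF_coef R i.

(** The binomial ['C(n, n-1-i)] is ['C(n, i+1)], that is, the falling factorial over [(i+1)!]. Of
    the [i+1] factors [n] in the denominator of the ratio, [i] cancel against [(n z)^i] and the last
    against the prefactor. *)
Lemma laguerre1E (R : realType) (n : nat) (z : R) : (0 < n)%N ->
  (laguerre R 1 n.-1).[z] = n%:R * limn (pseries (laguerre_coef R n) (n%:R * z)).
Proof.
case: n => // n _; rewrite /laguerre horner_poly /=.
have ne0 : (n.+1%:R : R) != 0 by rewrite pnatr_eq0.
have ne j : (j`!%:R : R) != 0 by rewrite pnatr_eq0 -lt0n fact_gt0.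
rewrite (_ : limn _ =
    \sum_(i < n.+1) laguerre_coef R n.+1 i * (n.+1%:R * z) ^+ i); last first.
  apply: lim_near_cst => //.
  near=> m; rewrite /pseries seriesEnat /=.
  have nm : (n.+1 <= m)%N by near: m; exact: nbhs_infty_ge.
  rewrite (big_cat_nat _ (n := n.+1))//= big_mkord [X in _ + X]big_nat_cond [X in _ + X]big1 ?addr0//.
  move=> i /andP[/andP[ni _] _].
  by rewrite /laguerre_coef /ffact_ratio ffact_small// !mul0r.
rewrite mulr_sumr; apply: eq_bigr => i _.
rewrite addn1 /laguerre_coef /ffact_ratio /besselF_coef.
have -> : (n - i = n.+1 - i.+1)%N by rewrite subSS.
rewrite bin_sub// -bin_ffact natrM exprMn [_ ^+ i.+1]exprS; field.
by rewrite !ne addrC natr1 expf_neq0 ?ne0.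
Unshelve. all: by end_near. Qed.

(** The defect of the ratio is at most ['C(i+1, 2) / n], and the [(i+1)!] in the denominator of
    [besselF_coef] absorbs this binomial. *)
Lemma laguerre_coef_dist (R : realType) (n i : nat) : (0 < n)%N ->
  `|laguerre_coef R n i - besselF_coef R i| <= n%:R^-1 / i`!%:R.
Proof.
move=> n0; have n0R : (0 : R) < n%:R by rewrite ltr0n.
rewrite /laguerre_coef -{2}[besselF_coef R i]mul1r -mulrBl normrM distrC.
rewrite [`|1 - _|]ger0_norm ?subr_ge0 ?ffact_ratio_le1//.
have -> : `|besselF_coef R i| = (i.+1`!%:R)^-1 / i`!%:R.
  rewrite /besselF_coef normrM normrX normrN1 expr1n mul1r normfV normrM !ger0_norm//.
  by rewrite invfM mulrC.
rewrite mulrA ler_wpM2r ?invr_ge0// ler_pdivrMr ?ltr0n ?fact_gt0//.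
rewrite lerBlDr -lerBlDl; apply: le_trans (ffact_ratio_ge _ _ n0).
rewrite lerD2l lerN2 mulrC ler_wpM2l ?invr_ge0// ler_nat.
case: i => [|i]; first by rewrite bin_small.
by rewrite -(bin_fact (isT : 2 <= i.+2)%N) leq_pmulr// muln_gt0 !fact_gt0.
Qed.

Lemma laguerre_besselF_dist (R : realType) (n : nat) (y : R) : (0 < n)%N ->
  `|limn (pseries (laguerre_coef R n) y) - besselF y| <= n%:R^-1 * expR `|y|.
Proof.
move=> n0; have dM i := laguerre_coef_dist R i n0.
have cb : cvgn (pseries (besselF_coef R) y).
  exact: is_cvg_pseries_fact (besselF_coef_fact R).
have cd := @is_cvg_pseries_fact _ _ _ y dM.
have cl : cvgn (pseries (laguerre_coef R n) y).
  apply: (@is_cvg_pseries_fact _ _ (n%:R^-1 + 1)) => i.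
  rewrite -[laguerre_coef _ _ _](subrK (besselF_coef R i)) mulrDl.
  by rewrite (le_trans (ler_normD _ _))// lerD ?besselF_coef_fact.
rewrite /besselF -lim_seriesB//.
apply: le_trans (norm_lim_pseries_le y dM).
rewrite le_eqVlt; apply/orP; left; apply/eqP; congr (`|limn (series _)|).
by apply/funext => i /=; rewrite mulrBl.
Qed.

(** * Quantitative comparison of Whittaker and Bessel functions *)

Lemma besselJ1_sqrt (R : realType) (lam x : R) : 0 <= lam ->
  Num.sqrt lam / 2 * besselJ 1 (Num.sqrt lam * x) =
  lam / 4 * x * besselF (lam / 4 * x ^+ 2).
Proof.
move=> lam0; set y := _ * x ^+ 2.
rewrite besselJ1E !exprMn sqr_sqrtr// exprVn.
have -> : lam * x ^+ 2 * (2 ^+ 2)^-1 = y by rewrite /y; field.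
by rewrite -{3}(sqr_sqrtr lam0); field.
Qed.

(** The bound is free of [x], hence uniform on [0 < x <= M]. In [1 + lam / 8 * M ^+ 2], the 1 comes
    from the Laguerre series and the rest from the exponential factor; [odd n] makes the sign
    positive. *)
Lemma whittakerW_besselJ_dist (R : realType) (n : nat) (beta lam M x : R) :
  odd n -> 0 <= beta -> 0 <= lam -> n%:R * beta = lam / 4 -> 0 < x <= M ->
  `|Num.sqrt lam / 2 * besselJ 1 (Num.sqrt lam * x)
     - x^-1 * whittakerW n (beta * x ^+ 2)| <=
  lam / 4 * M * (1 + lam / 8 * M ^+ 2) * expR (lam / 4 * M ^+ 2) / n%:R.
Proof.
move=> on beta0 lam0 nb /andP[x0 xM].
have n0 : (0 < n)%N by case: n on {nb}.
have n0R : (0 : R) < n%:R by rewrite ltr0n.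
have M0 : 0 < M := lt_le_trans x0 xM.
have x2M : x ^+ 2 <= M ^+ 2 by rewrite lerXn2r// nnegrE ltW.
set y := lam / 4 * x ^+ 2.
have y0 : 0 <= y by rewrite mulr_ge0 ?sqr_ge0 ?divr_ge0.
have -> : Num.sqrt lam / 2 * besselJ 1 (Num.sqrt lam * x) = lam / 4 * x * besselF y.
  exact: besselJ1_sqrt.
have evn : odd n.-1 = false by case: n on {n0 n0R nb} => //= n /negbTE.
have -> : x^-1 * whittakerW n (beta * x ^+ 2) = lam / 4 * x *
    (expR (- (beta * x ^+ 2) / 2) * limn (pseries (laguerre_coef R n) y)).
  rewrite /whittakerW laguerre1E// -signr_odd evn expr0 mulrA nb -/y -nb.
  by field; rewrite gt_eqF.
set F := besselF y; set L := limn _; set e := expR _.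
have LF : `|L - F| <= n%:R^-1 * expR y.
  by have := laguerre_besselF_dist y n0; rewrite (ger0_norm y0).
have Fy : `|F| <= expR y.
  have := norm_lim_pseries_le y (besselF_coef_fact R).
  by rewrite mul1r (ger0_norm y0).
have e1 : e <= 1 by rewrite -expR0 ler_expR mulNr oppr_le0 divr_ge0// mulr_ge0// sqr_ge0.
have e0 : 0 <= e by exact: expR_ge0.
(* By [1 + t <= exp t], the defect is at most [beta x^2 / 2], and [beta = lam / (4 n)]. *)
have le : 1 - e <= lam / 8 * M ^+ 2 / n%:R.
  have := expR_ge1Dx (- (beta * x ^+ 2) / 2); rewrite -/e => he.
  apply: (@le_trans _ _ (beta * x ^+ 2 / 2)); first lra.
  have -> : lam / 8 * M ^+ 2 / n%:R = beta * M ^+ 2 / 2.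
    have -> : lam / 8 = n%:R * beta / 2 by rewrite nb; field.
    by field; rewrite gt_eqF.
  by rewrite ler_wpM2r// ler_wpM2l.
have yM : expR y <= expR (lam / 4 * M ^+ 2).
  by rewrite ler_expR ler_wpM2l// divr_ge0.
have FL : `|F - e * L| <= (1 + lam / 8 * M ^+ 2) * expR (lam / 4 * M ^+ 2) / n%:R.
  (* This separates the error of the exponential, weighted by [F], from that of the Laguerre series,
     weighted by [e <= 1]. *)
  have -> : F - e * L = (1 - e) * F - e * (L - F) by ring.
  apply: le_trans (ler_normB _ _) _.
  rewrite !normrM (ger0_norm e0) [`|1 - e|]ger0_norm ?subr_ge0//.
  apply: (@le_trans _ _ (lam / 8 * M ^+ 2 / n%:R * expR y + n%:R^-1 * expR y)).
    apply: lerD; first by rewrite ler_pM// subr_ge0.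
    by apply: le_trans LF; rewrite ler_piMl.
  have -> : lam / 8 * M ^+ 2 / n%:R * expR y + n%:R^-1 * expR y =
      (1 + lam / 8 * M ^+ 2) * expR y / n%:R by ring.
  rewrite ler_wpM2r ?invr_ge0// ler_wpM2l// addr_ge0// mulr_ge0 ?sqr_ge0//.
  by rewrite divr_ge0.
rewrite -mulrBr normrM ger0_norm; last by rewrite mulr_ge0 ?divr_ge0// ltW.
have -> : lam / 4 * M * (1 + lam / 8 * M ^+ 2) * expR (lam / 4 * M ^+ 2) / n%:R =
    lam / 4 * M * ((1 + lam / 8 * M ^+ 2) * expR (lam / 4 * M ^+ 2) / n%:R).
  by rewrite !mulrA.
rewrite ler_pM//.
  by rewrite mulr_ge0 ?divr_ge0// ltW.
by rewrite ler_wpM2l// divr_ge0.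
Qed.

(** * Uniform convergence on compact sets *)

Lemma norm_expi_mul_real (R : realType) (t a : R) :
  `|expi t * a%:C%C| = `|a|%:C%C.
Proof.
rewrite normrM !normc_def /= cos2Dsin2 sqrtr1 mul1r expr0n addr0 sqrtr_sqr.
by [].
Qed.

Lemma compact_fst_bounded (R : realType) (K : set (R * R[i]^o)) :
  compact K -> exists2 M, 0 < M & forall p, K p -> p.1 <= M.
Proof.
move=> cK.
have : compact (fst @` K).
  apply: continuous_compact => //.
  by apply: continuous_subspaceT => p; exact: cvg_fst.
move=> /compact_bounded[M0 [_ hM]].
exists (`|M0| + 1); first by rewrite ltr_wpDl.
move=> p Kp; apply: le_trans (ler_norm _) _; apply: (hM (`|M0| + 1)) => /=.
  by rewrite (le_lt_trans (ler_norm _))// ltrDl.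
by exists p.
Qed.

Lemma psi_cvg_besselJ (R : realType) (k : int) (lam : R) : 0 < lam ->
  exists (b : nat -> R) (n : nat -> nat),
     [/\ forall j, [/\ k%:~R - 1 / 2 < b j < k%:~R + 1 / 2,
                       b j != k%:~R & (0 < n j)%N],
         b @ \oo --> (k%:~R : R),
         n @ \oo --> \oo
       & cvg_uniformly_on_compacts (fun j => psi (b j) (n j) k)
           (limit_fun k lam)].
Proof.
move=> lam0.
(* As [n j >= N > lam], the shift [beta j = lam / (4 n j)] stays below 1/2. *)
pose N := (Num.truncn lam).+1.
have lamN : lam < N%:R by exact: truncnS_gt.
pose n j := (j + N).*2.+1.
have nN j : (N%:R : R) <= (n j)%:R by rewrite ler_nat /n; lia.
have n0 j : (0 : R) < (n j)%:R by rewrite ltr0n.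
pose beta j : R := lam / 4 / (n j)%:R.
have beta0 j : 0 < beta j by rewrite !divr_gt0.
have nj j : (j <= n j)%N by rewrite /n; lia.
have ninv : (fun j => ((n j)%:R : R)^-1) @ \oo --> 0.
  apply: (@squeeze_cvgr _ _ _ _ (cst 0) harmonic); last 2 first.
  - exact: cvg_cst.
  - exact: cvg_harmonic.
  near=> j; rewrite invr_ge0 ler0n /= /harmonic lef_pV2 ?posrE ?ltr0n// ler_nat /n.
  by lia.
exists (fun j => k%:~R + beta j), n; split.
- move=> j; split.
  + have : beta j < 1 / 2.
      rewrite /beta ltr_pdivrMr//; have := nN j; lra.
    have := beta0 j; lra.
  + by rewrite -subr_eq0 addrC addKr gt_eqF.
  + by [].
- rewrite -[X in _ --> X]addr0; apply: cvgD; first exact: cvg_cst.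
  rewrite -[X in _ --> X](mulr0 (lam / 4)); apply: cvgM ninv; exact: cvg_cst.
- apply/cvgnyPge => A; near=> j; apply: leq_trans (nj j).
  by near: j; exact: nbhs_infty_ge.
move=> K cK KM; have [M M0 hM] := compact_fst_bounded cK.
pose C := lam / 4 * M * (1 + lam / 8 * M ^+ 2) * expR (lam / 4 * M ^+ 2).
have Cn : (fun j => C / (n j)%:R) @ \oo --> 0.
  rewrite -[X in _ --> X](mulr0 C); apply: cvgM ninv; exact: cvg_cst.
move=> P /uniform_nbhs[E [entE EP]].
move: entE; rewrite -entourage_ballE => -[e /= e0 eE].
(* Radii of balls in [R[i]^o] are elements of [R[i]]; a positive one is real. *)
have /complex_realP[e' ee'] : e \is Num.real by exact: gtr0_real.
have e'0 : 0 < e' by move: e0; rewrite ee' ltcR.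
move/cvgrPdist_lt : Cn => /(_ _ e'0) Cn.
near=> j; apply: EP => -[x t] /= Kxt; apply: eE.
have [/= x0 _] := KM _ Kxt; have /= xM := hM _ Kxt.
rewrite /ball /= /psi /limit_fun /= -mulrBr -rmorphB /= norm_expi_mul_real ee' ltcR.
have -> : `|k%:~R - (k%:~R + beta j)| = beta j.
  by rewrite opprD addNKr normrN gtr0_norm.
apply: le_lt_trans (whittakerW_besselJ_dist _ _ _ _ (_ : 0 < x <= M)) _ => //.
- by rewrite /n /= odd_double.
- exact: ltW.
- exact: ltW.
- by rewrite /beta mulrC divfK// gt_eqF.
- by rewrite x0.
have : `|0 - C / (n j)%:R| < e' by near: j.
by rewrite sub0r normrN; apply: le_lt_trans; exact: ler_norm.
Unshelve. all: by end_near. Qed.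

(** * The limit is a generalised eigenfunction *)

(** Meant for second derivatives: the first derivative of [u] is identified with [u1] only on the
    positive half-line, which is a neighbourhood of each of its points. *)
Lemma derive1_on_pos (R : realType) (f g dg : R -> R) (x : R) :
  (forall z, 0 < z -> f z = g z) ->
  (forall z : R, 0 < z -> is_derive z 1 g (dg z)) ->
  0 < x -> derivable f x 1 /\ (f^`())%classic x = dg x.
Proof.
move=> fg dgP x0.
have h : is_derive x 1 f (dg x).
  apply: near_eq_is_derive (dgP _ x0).
  by near=> z; apply/esym/fg; near: z; exact: lt_nbhsr.
by split; [exact: ex_derive|rewrite derive1E; exact: derive_val].
Unshelve. all: by end_near. Qed.

(* With [S = Num.sqrt x], [u = a S^3 F(q S^4)], which turns [- L0 u = 4 q u] into
   the differential equation of [besselF]. *)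
Lemma besselF_solves_L0 (R : realType) (q a : R) :
  solves_L0 (4 * q) (fun x : R => a * (Num.sqrt x ^+ 3 * besselF (q * x ^+ 2))).
Proof.
set u := fun x => _.
pose c := besselF_coef R; have cM : forall i, `|c i| <= 1 / i`!%:R.
  exact: besselF_coef_fact.
pose F1 (y : R) := limn (pseries (pseries_diffs c) y).
pose F2 (y : R) := limn (pseries (pseries_diffs (pseries_diffs c)) y).
have dF (y : R) : is_derive y 1 (@besselF R) (F1 y).
  exact: is_derive_pseries_fact cM.
have dF1 (y : R) : is_derive y 1 F1 (F2 y).
  exact: is_derive_pseries_fact (pseries_diffs_fact cM).
pose u1 x : R := a * (3 / 2 * Num.sqrt x * besselF (q * x ^+ 2)
   + 2 * q * (Num.sqrt x ^+ 5 * F1 (q * x ^+ 2))).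
pose u2 x : R := a * (3 / 4 / Num.sqrt x * besselF (q * x ^+ 2)
   + 8 * q * (Num.sqrt x ^+ 3 * F1 (q * x ^+ 2))
   + 4 * q ^+ 2 * (Num.sqrt x ^+ 7 * F2 (q * x ^+ 2))).
have dq (x : R) : is_derive x 1 (fun x => q * x ^+ 2) (2 * q * x).
  have -> : (fun x => q * x ^+ 2) = q *: (@id R ^+ 2) by apply/funext.
  by apply: is_derive_eq; rewrite /GRing.scale /=; ring.
have dFq (x : R) : is_derive x 1 (fun x => besselF (q * x ^+ 2)) (2 * q * x * F1 (q * x ^+ 2)).
  have := @is_derive1_comp _ (@besselF R) (fun x => q * x ^+ 2) x _ _ (dF _) (dq x).
  by rewrite [in X in X -> _]mulrC.
have dF1q (x : R) : is_derive x 1 (fun x => F1 (q * x ^+ 2)) (2 * q * x * F2 (q * x ^+ 2)).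
  have := @is_derive1_comp _ F1 (fun x => q * x ^+ 2) x _ _ (dF1 _) (dq x).
  by rewrite [in X in X -> _]mulrC.
(* With [x = s^2] the identities below become rational in [s], within reach of [field]. *)
have sq (x : R) : 0 < x -> exists2 s : R, 0 < s & Num.sqrt x = s /\ x = s ^+ 2.
  by move=> x0; exists (Num.sqrt x); rewrite ?sqrtr_gt0// sqr_sqrtr ?ltW.
have du (x : R) : 0 < x -> is_derive x 1 u (u1 x).
  move=> x0; have ds := is_derive1_sqrt x0.
  have -> : u = a *: (@Num.sqrt R ^+ 3 * (fun x => besselF (q * x ^+ 2))) by apply/funext.
  apply: (is_derive_eq (is_deriveZ a (is_deriveM (is_deriveX 3 ds) (dFq x)))).
  rewrite /GRing.scale /= /u1 !exprfctE.
  move: (besselF _) (F1 _) => A B.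
  have [s s0 [-> ->]] := sq _ x0.
  by field; rewrite gt_eqF.
have du1 (x : R) : 0 < x -> is_derive x 1 u1 (u2 x).
  move=> x0; have ds := is_derive1_sqrt x0.
  have -> : u1 = a *: ((3 / 2) *: (@Num.sqrt R * (fun x => besselF (q * x ^+ 2)))
     + (2 * q) *: (@Num.sqrt R ^+ 5 * (fun x => F1 (q * x ^+ 2)))).
    by apply/funext => z; rewrite /u1 -mulrA.
  apply: (is_derive_eq (is_deriveZ a (is_deriveD
    (is_deriveZ (3 / 2) (is_deriveM ds (dFq x)))
    (is_deriveZ (2 * q) (is_deriveM (is_deriveX 5 ds) (dF1q x)))))).
  rewrite /GRing.scale /= /u2 !exprfctE.
  move: (besselF _) (F1 _) (F2 _) => A B D.
  have [s s0 [-> ->]] := sq _ x0.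
  by field; rewrite gt_eqF.
move=> x x0; rewrite /L0.
have [h1 e1] := derive1_on_pos (fun z _ => erefl) du x0.
have [h2 e2] := derive1_on_pos (fun z z0 => (derive1_on_pos (fun z _ => erefl) du z0).2) du1 x0.
split=> //; rewrite derive1nS derive1n1 e2 /u2 /u.
have ode : q * x ^+ 2 * F2 (q * x ^+ 2) + 2 * F1 (q * x ^+ 2)
  + besselF (q * x ^+ 2) = 0 := besselF_ode _.
move: (besselF _) (F1 _) (F2 _) ode => A B D ode.
(* The terms in [A / s] cancel, the exponent 3/2 of [x] being a root of [r (r - 1) = 3 / 4]; the
   equation of [F] accounts for the rest. *)
have {ode} -> : A = - (q * x ^+ 2 * D + 2 * B)
  by apply/eqP; rewrite -addr_eq0 addrC ode.
have [s s0 [-> ->]] := sq _ x0.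
by field; rewrite gt_eqF.
Qed.

Lemma besselF0 (R : realType) : besselF 0 = 1 :> R.
Proof.
apply: lim_near_cst => //; near=> n.
have n0 : (0 < n)%N by near: n; exact: nbhs_infty_gt.
rewrite /pseries seriesEnat /= -(prednK n0) big_nat_recl// big1 ?addr0.
  by rewrite /besselF_coef !expr0 factS !fact0 !mulr1 divr1.
by move=> i _; rewrite expr0n mulr0.
Unshelve. all: by end_near. Qed.

(** Gives the nontriviality required of an eigenfunction: [F] is continuous and [F 0 = 1]. *)
Lemma besselF_neq0_ex (R : realType) (q : R) : 0 < q ->
  exists2 x, 0 < x & besselF (q * x ^+ 2) != 0.
Proof.
move=> q0.
have /derivable1_diffP/differentiable_continuous cF : derivable (@besselF R) 0 1.
  exact: (@ex_derive _ _ _ _ _ _ _ (is_derive_pseries_fact 0 (besselF_coef_fact R))).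
have nz : nbhs (besselF (0 : R)) [set z | z != 0].
  by rewrite besselF0; apply: open_nbhs_nbhs; split; [exact: open_neq|exact: oner_neq0].
have [e /= e0 he] := cF _ nz.
(* Chosen so that [q x^2 = e / 2] lies in the ball around 0 where [F] does not vanish. *)
exists (Num.sqrt (e / 2 / q)); first by rewrite sqrtr_gt0 !divr_gt0.
have e2 : 0 < e / 2 by rewrite divr_gt0.
rewrite sqr_sqrtr ?divr_ge0 ?ltW// mulrC divfK ?(gt_eqF q0)//.
apply: he => /=; rewrite sub0r normrN gtr0_norm//; lra.
Qed.

Lemma limit_fun_eigenfunction (R : realType) (k : int) (lam : R) : 0 < lam ->
  generalised_eigenfunction k lam (limit_fun k lam).
Proof.
move=> lam0; pose q := lam / 4; have q0 : 0 < q by rewrite divr_gt0.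
have lamE : lam = 4 * q by rewrite /q; field.
pose u x : R := q * (Num.sqrt x ^+ 3 * besselF (q * x ^+ 2)).
exists (fun x => (u x)%:C%C); split => /=.
- by rewrite lamE; exact: besselF_solves_L0.
(* The zero imaginary part is the solution with [a = 0]. *)
- have -> : (fun=> 0) = fun x : R => 0 * (Num.sqrt x ^+ 3 * besselF (q * x ^+ 2)).
    by apply/funext => x; rewrite mul0r.
  by rewrite lamE; exact: besselF_solves_L0.
- have [x x0 Fx] := besselF_neq0_ex q0; exists x => //.
  by rewrite fmorph_eq0 !mulf_neq0// ?expf_neq0// gt_eqF// sqrtr_gt0.
move=> x t x0; rewrite /limit_fun /Uinv /= -rmorphM /=; congr (_ * _%:C%C).
rewrite besselJ1_sqrt ?ltW// /u -/q.
have s0 : 0 < Num.sqrt x by rewrite sqrtr_gt0.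
have {1}-> : x = Num.sqrt x ^+ 2 by rewrite sqr_sqrtr ?ltW.
by field; rewrite gt_eqF.
Qed.

Theorem theorem2p9 (R : realType) (k : int) (lam : rat) (lam_gt0 : 0 < lam) :
  (exists (b : nat -> R) (n : nat -> nat),
     [/\ forall j, [/\ k%:~R - 1 / 2 < b j < k%:~R + 1 / 2,
                       b j != k%:~R & (0 < n j)%N],
         b @ \oo --> (k%:~R : R),
         n @ \oo --> \oo
       & cvg_uniformly_on_compacts (fun j => psi (b j) (n j) k)
           (limit_fun k (ratr lam))])
  /\ generalised_eigenfunction k (ratr lam : R) (limit_fun k (ratr lam)).
Proof.
have lam0 : (0 : R) < ratr lam by rewrite ltr0q.
by split; [exact: psi_cvg_besselJ|exact: limit_fun_eigenfunction].
Qed.
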